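(* Fix constants $r\geq 2$ (an integer) and $\ell\in[0,1]$ such that $\deg_{1/3}(\operatorname{ED}^r_{n})=\Omega(n^{\ell})$ (as $n\to\infty$). Then \[\deg_{\epsilon}(\operatorname{ED}^r_{n}) =\Omega\left(n^{\ell}\left(\log\frac{1}{\epsilon}\right)^{1-\ell}\right)\] for all $\epsilon$ with $3^{-n}\leq\epsilon\leq 1/3$, i.e. there is a constant $c>0$ such that $\deg_{\epsilon}(\operatorname{ED}^r_{n})\geq c\,n^{\ell}(\log(1/\epsilon))^{1-\ell}$ for all $n\ge 1$ and all such $\epsilon$.
   Context: Let $\mathcal{D}_{n,n}$ denote the set of Boolean $n\times n$ matrices in which every row contains exactly one $1$, viewed as a subset of $\{0,1\}^{n^2}\subseteq\mathbb{R}^{n^2}$. The $k$-element distinctness function $\operatorname{ED}^k_n\colon\mathcal{D}_{n,n}\to\{0,1\}$ evaluates to $1$ if and only if no column of the input matrix contains $k$ or more $1$s. For a function $f\colon X\to\mathbb{R}$ on a finite set $X\subseteq\mathbb{R}^N$, $\deg_\epsilon(f)$ is the least total degree of a real polynomial $p$ on $\mathbb{R}^N$ with $|p(x)-f(x)|\leq\epsilon$ for all $x\in X$ (no constraint outside $X$).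
   Formalization: The bound is stated for all n ≥ r instead of all n ≥ 1: for 1 ≤ n < r no column can contain r ones, so ED^r_n is constantly 1 and has approximate degree 0, and the claimed positive lower bound fails there. *)

(* Defs.v *)
From mathcomp Require Export all_boot all_order all_algebra.
From mathcomp Require Export boolp classical_sets reals exp.
From mathcomp Require Export mpoly.

Set Implicit Arguments.
Unset Strict Implicit.
Unset Printing Implicit Defensive.

Import Order.TTheory GRing.Theory Num.Theory.
Local Open Scope classical_set_scope.
Local Open Scope ring_scope.

(* [msize p] is 1 plus the total degree; the zero polynomial gets degree 0. *)
Definition total_degree (R : realType) (N : nat) (p : {mpoly R[N]}) : nat :=
  (msize p).-1.

Definition approximates (R : realType) (N : nat) (eps : R)
    (X : set ('I_N -> R)) (f : ('I_N -> R) -> R) (p : {mpoly R[N]}) : Prop :=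
  forall x, X x -> `|p.@[x] - f x| <= eps.

(* Only the values of [f] on [X] matter.  For finite [X] and [0 <= eps] an
   interpolating polynomial exists, so the set below is a singleton and the
   default value of [get] plays no role. *)
Definition approx_deg (R : realType) (N : nat) (eps : R)
    (X : set ('I_N -> R)) (f : ('I_N -> R) -> R) : nat :=
  get [set d : nat |
    (exists2 p, approximates eps X f p & total_degree p = d) /\
    (forall p, approximates eps X f p -> (d <= total_degree p)%N)].

(* A point of R^(n * n) is an n x n matrix whose (i, j) entry is the coordinate
   of index [mxvec_index i j]. *)
Definition entry (R : realType) (n : nat) (x : 'I_(n * n) -> R) (i j : 'I_n) : R :=
  x (mxvec_index i j).

Definition ED_dom (R : realType) (n : nat) : set ('I_(n * n) -> R) :=
  [set x | (forall i j, entry x i j = 0 \/ entry x i j = 1) /\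
           (forall i, #|[set j | entry x i j == 1%R]%SET| = 1%N)].

Definition ED (R : realType) (k n : nat) (x : 'I_(n * n) -> R) : R :=
  [forall j : 'I_n, #|[set i | entry x i j == 1%R]%SET| < k]%N%:R.

(* Main.v *)
(* Linear programming duality turns deg_{1/3}(ED_k) >= d into a function psi on
   the inputs with l1-norm at most 1 that is orthogonal to all polynomials of
   degree < d and correlates with ED_k by at least 1/3.  A monomial of degree
   < m d in m blocks of variables has degree < d in some block, so the m-fold
   tensor power of psi is orthogonal to all polynomials of degree < m d, while it
   correlates with ED_k(x_1) ... ED_k(x_m) by at least 3^-m.  As this product is
   ED_n on block diagonal matrices, deg_eps(ED_n) >= m deg_{1/3}(ED_k) for
   eps < 3^-m and m k <= n; the bound follows with m of order log(1/eps) and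
   k = n / m. *)
Require Import Defs.
From mathcomp Require Import ring lra zify.

Set Implicit Arguments.
Unset Strict Implicit.
Unset Printing Implicit Defensive.

Import Order.TTheory GRing.Theory Num.Theory.
Local Open Scope ring_scope.

(** * Domination by linear functionals and duality *)

Section HahnBanach.
Variables (R : realType) (E : lmodType R).
Implicit Types (N : E -> R) (u v f : E) (s t : R).

Definition sublinear N : Prop :=
  (forall u v, N (u + v) <= N u + N v) /\
  (forall s u, 0 <= s -> N (s *: u) <= s * N u).

Lemma sublinear0 N : sublinear N -> N 0 = 0.
Proof.
move=> [ND NZ]; apply/eqP; rewrite eq_le; apply/andP; split.
  by have := NZ 0 0 (lexx 0); rewrite scale0r mul0r.
by have := ND 0 0; rewrite addr0; lra.
Qed.

Lemma sublinear_opp N u : sublinear N -> 0 <= N u + N (- u).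
Proof. by move=> hN; rewrite -(sublinear0 hN) -(subrr u); exact: hN.1. Qed.

Lemma sublinearZ N s u : sublinear N -> 0 <= s -> N (s *: u) = s * N u.
Proof.
move=> hN s0; have [->|sn0] := eqVneq s 0.
  by rewrite scale0r mul0r sublinear0.
apply/eqP; rewrite eq_le hN.2 //= -ler_pdivlMl ?lt0r ?sn0 //.
by have := hN.2 s^-1 (s *: u); rewrite scalerA mulVf // scale1r; apply; rewrite invr_ge0.
Qed.

(** Take [N' u] to be the infimum of [N (u + t *: f) - t * N f] over [t >= 0]. Together with
    [sublinear_opp] for [N'], the conclusion forces [N' f = N f] and [N' (- f) = - N' f], so [N'] is
    linear along [f]. *)
Lemma sublinear_make_odd N f : sublinear N -> exists N', sublinear N' /\
  (forall u, N' u <= N u) /\ N' (- f) <= - N f.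
Proof.
move=> hN; pose A u := [set N (u + t *: f) - t * N f | t in [set t | 0 <= t]]%classic.
have Alb u : has_lbound (A u).
  exists (- N (- u)) => _ [t /= t0 <-].
  rewrite -sublinearZ //.
  have := hN.1 (u + t *: f) (- u); rewrite addrAC subrr add0r; lra.
have A0 u : (A u !=set0)%classic by exists (N (u + 0 *: f) - 0 * N f); exists 0 => /=.
have infA u t : 0 <= t -> inf (A u) <= N (u + t *: f) - t * N f.
  by move=> t0; apply: ge_inf => //; exists t.
exists (fun u => inf (A u)); split; last split.
- split=> [u v|s u s0].
  + suff : inf (A (u + v)) - inf (A v) <= inf (A u) by lra.
    apply: lb_le_inf => // _ [s /= s0 <-].
    suff : inf (A (u + v)) - (N (u + s *: f) - s * N f) <= inf (A v) by lra.
    apply: lb_le_inf => // _ [t /= t0 <-].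
    have := infA (u + v) (s + t) (addr_ge0 s0 t0).
    have := hN.1 (u + s *: f) (v + t *: f).
    rewrite addrACA -scalerDl; lra.
  + have [->|sn0] := eqVneq s 0.
      rewrite scale0r mul0r.
      by have := infA 0 0 (lexx 0); rewrite scale0r addr0 mul0r subr0 sublinear0.
    have sp : 0 < s by rewrite lt0r sn0.
    rewrite -ler_pdivrMl //; apply: lb_le_inf => // _ [t /= t0 <-].
    rewrite ler_pdivrMl //.
    have := infA (s *: u) (s * t) (mulr_ge0 s0 t0).
    by rewrite -scalerA -scalerDr sublinearZ // mulrBr mulrA.
- by move=> u; have := infA u 0 (lexx 0); rewrite scale0r addr0 mul0r subr0.
- have := infA (- f) 1 ler01.
  by rewrite scale1r addNr sublinear0 // mul1r add0r.
Qed.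

(** Oddness at [f] survives further lowering: if [N2 <= N1 <= N] and [N1 (- f) <= - N f], then
    [N2 (- f) <= - N f <= - N2 f]. *)
Lemma sublinear_make_odd_seq N (fs : seq E) : sublinear N ->
  exists N', sublinear N' /\ (forall u, N' u <= N u) /\
             (forall f, f \in fs -> N' (- f) <= - N' f).
Proof.
elim: fs N => [|f fs IH] N hN; first by exists N.
have [N1 [hN1 [leN1 N1f]]] := sublinear_make_odd f hN.
have [N2 [hN2 [leN2 N2fs]]] := IH N1 hN1.
exists N2; split=> //; split=> [u|g]; first exact: le_trans (leN2 u) (leN1 u).
rewrite inE => /orP[/eqP ->|/N2fs //].
have := leN2 (- f); have := leN2 f; have := leN1 f; lra.
Qed.

End HahnBanach.

Section Duality.
Variables (R : realType) (T : finType).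
Local Notation E := {ffun T -> R^o}.

(** A sublinear functional that is odd on a finite basis is linear, so finitely many lowering steps
    replace Zorn's lemma; [psi] lists its values on the indicator functions. Treating [f] first
    secures the value there. *)
Lemma hahn_banach_ffun (N : E -> R) (f : E) : sublinear N ->
  exists psi : T -> R, (forall u : E, \sum_t psi t * u t <= N u) /\
    N f <= \sum_t psi t * f t.
Proof.
move=> hN; have [N1 [hN1 [leN1 N1f]]] := sublinear_make_odd f hN.
pose delta (t : T) : E := [ffun x => (x == t)%:R].
have [N2 [hN2 [leN2 N2d]]] := sublinear_make_odd_seq [seq delta t | t <- enum T] hN1.
have N2Z a t : N2 (a *: delta t) <= N2 (delta t) * a.
  have [a0|a0] := leP 0 a; first by rewrite sublinearZ // mulrC.
  rewrite -[a]opprK scaleNr -scalerN sublinearZ //; last lra.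
  rewrite mulrN mulrC -mulNr ler_wpM2r //; first lra.
  by apply: N2d; rewrite map_f // mem_enum.
have le_sum (u : E) : N2 u <= \sum_t N2 (delta t) * u t.
  have uE : u = \sum_t u t *: delta t.
    apply/ffunP => x; rewrite sum_ffunE (bigD1 x) //= big1 => [|t tx].
      by rewrite !ffunE eqxx addr0 /GRing.scale /= mulr1.
    by rewrite !ffunE eq_sym (negbTE tx) /GRing.scale /= mulr0.
  rewrite {1}uE; elim/big_ind2: _ => [|x1 y1 x2 y2 h1 h2|t _].
  + by rewrite sublinear0.
  + by have := hN2.1 y1 y2; lra.
  + exact: N2Z.
have sumN (u : E) : \sum_t N2 (delta t) * (- u) t = - \sum_t N2 (delta t) * u t.
  by rewrite -sumrN; apply: eq_bigr => t _; rewrite !ffunE mulrN.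
have sum_le (u : E) : \sum_t N2 (delta t) * u t <= N2 u.
  by have := le_sum (- u); have := sublinear_opp u hN2; rewrite sumN; lra.
exists (fun t => N2 (delta t)); split=> [u|].
  exact: le_trans (sum_le u) (le_trans (leN2 u) (leN1 u)).
have := sum_le (- f); have := leN2 (- f); rewrite sumN; lra.
Qed.

(** The uniform distance to the subspace [V] is sublinear, at most the sup norm, zero on [V] and at
    least [delta] at [f]. A linear functional dominated by it and at least as large at [f] is the
    desired [psi]. *)
Lemma uniform_distance_dual (V : E -> Prop) (f : E) (delta : R) :
  V 0 -> (forall u v, V u -> V v -> V (u + v)) -> (forall a u, V u -> V (a *: u)) ->
  (forall v, V v -> exists t, delta <= `|f t - v t|) ->
  exists psi : T -> R, [/\ \sum_t `|psi t| <= 1, delta <= \sum_t psi t * f t &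
    forall v, V v -> \sum_t psi t * v t = 0].
Proof.
move=> V0 VD VZ fV.
pose A (u : E) := [set e : R | 0 <= e /\ exists2 v, V v & forall t, `|u t - v t| <= e]%classic.
have Alb u : has_lbound (A u) by exists 0 => e [].
have A0 u : (A u !=set0)%classic.
  exists (\sum_t `|u t|); split; first exact: sumr_ge0.
  exists 0 => // t; rewrite ffunE subr0.
  by rewrite (bigD1 t) //= lerDl sumr_ge0.
have infA (u v : E) (e : R) : 0 <= e -> V v -> (forall t, `|u t - v t| <= e) -> inf (A u) <= e.
  by move=> e0 Vv uv; apply: ge_inf => //; split=> //; exists v.
have subN : sublinear (fun u => inf (A u)).
  split=> [u v|s u s0].
    suff : inf (A (u + v)) - inf (A v) <= inf (A u) by lra.
    apply: lb_le_inf => // e [e0 [u' Vu' hu]].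
    suff : inf (A (u + v)) - e <= inf (A v) by lra.
    apply: lb_le_inf => // e' [e'0 [v' Vv' hv]].
    suff : inf (A (u + v)) <= e + e' by lra.
    apply: (infA _ (u' + v')); [lra|exact: VD|move=> t].
    rewrite !ffunE opprD addrACA; apply: le_trans (ler_normD _ _) _.
    exact: lerD.
  have [->|sn0] := eqVneq s 0.
    rewrite scale0r mul0r; apply: (infA _ 0) => // t.
    by rewrite !ffunE subrr normr0.
  have sp : 0 < s by rewrite lt0r sn0.
  rewrite -ler_pdivrMl //; apply: lb_le_inf => // e [e0 [v Vv hv]].
  rewrite ler_pdivrMl //; apply: (infA _ (s *: v)); [exact: mulr_ge0|exact: VZ|].
  move=> t; rewrite !ffunE -scalerBr normrM ger0_norm // ler_pM2l //.
have [psi [psiN psif]] := hahn_banach_ffun f subN.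
exists psi; split.
(* The sign vector of [psi] lies within distance 1 of [0], and its pairing with [psi] is the
   l1-norm. *)
- have := psiN [ffun t => Num.sg (psi t)].
  under eq_bigr => t _ do rewrite ffunE mulrC -normrEsg.
  move=> h; apply: le_trans h _; apply: (infA _ 0) => // t.
  by rewrite !ffunE subr0 normr_sg lern1 leq_b1.
- apply: le_trans psif; apply: lb_le_inf => // e [e0 [v Vv hv]].
  by have [t ft] := fV v Vv; exact: le_trans ft (hv t).
- have le0 (v : E) : V v -> \sum_t psi t * v t <= 0.
    move=> Vv; apply: le_trans (psiN v) _; apply: (infA _ v) => // t.
    by rewrite subrr normr0.
  move=> v Vv; apply/eqP; rewrite eq_le le0 //=.
  have := le0 _ (VZ (- 1) v Vv); rewrite -oppr_le0 -sumrN.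
  by congr (_ <= _); apply: eq_bigr => t _; rewrite !ffunE scaleN1r mulrN.
Qed.
End Duality.

(** * Tensor powers of dual witnesses *)

Section Tensor.
Variable (R : realType).

Lemma msizeM_bound N (p q : {mpoly R[N]}) a b :
  (msize p <= a.+1 -> msize q <= b.+1 -> msize (p * q) <= (a + b).+1)%N.
Proof.
have [->|p0] := eqVneq p 0; first by rewrite mul0r msize0.
have [->|q0] := eqVneq q 0; first by rewrite mulr0 msize0.
rewrite msizeM //; move: (mmeasure _ p) (mmeasure _ q) => x y; lia.
Qed.

Lemma msize_prod_exp N (I : finType) (P : pred I) (q : I -> {mpoly R[N]}) (e : I -> nat) :
  (forall i, msize (q i) <= 2)%N ->
  (msize (\prod_(i | P i) q i ^+ e i) <= (\sum_(i | P i) e i).+1)%N.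
Proof.
move=> hq; apply: (big_rec2 (fun p s => msize p <= s.+1)%N) => [|i p s _ hs].
  by rewrite msize1.
apply: msizeM_bound => //; elim: (e i) => [|k IH]; first by rewrite expr0 msize1.
by rewrite exprS; apply: (@msizeM_bound _ _ _ 1).
Qed.

(** As [msize] is one more than the degree, [msize p <= d] says that the degree is below [d]. *)
Definition pure_high (T : finType) N (y : T -> 'I_N -> R) (d : nat) (psi : T -> R) : Prop :=
  forall p : {mpoly R[N]}, (msize p <= d)%N -> \sum_t psi t * p.@[y t] = 0.

(** Degree at most 1 for [q v] covers both constant coordinates and coordinates copied from block
    [blk v]. The sum of a monomial over all [G] factors over the blocks, and a block that receives
    degree below [d] contributes a factor 0. *)
Lemma pure_high_tensor (T : finType) M N m d (y : T -> 'I_M -> R) (psi : T -> R)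
    (Y : {ffun 'I_m -> T} -> 'I_N -> R) (blk : 'I_N -> 'I_m) (q : 'I_N -> {mpoly R[M]}) :
  (forall v, msize (q v) <= 2)%N ->
  (forall G v, Y G v = (q v).@[y (G (blk v))]) ->
  pure_high y d psi -> pure_high Y (m * d) (fun G => \prod_a psi (G a)).
Proof.
move=> hq hY hpsi P hP.
under eq_bigr => G _ do rewrite mevalE mulr_sumr.
rewrite exchange_big /= big1_seq // => mon /andP[_ monP].
under eq_bigr => G _ do rewrite mulrCA.
rewrite -mulr_sumr [X in _ * X](_ : _ = 0) ?mulr0 //.
pose h a : {mpoly R[M]} := \prod_(v | blk v == a) q v ^+ mon v.
transitivity (\sum_(G : {ffun 'I_m -> T}) \prod_a (psi (G a) * (h a).@[y (G a)])).
  apply: eq_bigr => G _; rewrite big_split /=; congr (_ * _).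
  rewrite (partition_big blk xpredT) //=; apply: eq_bigr => a _.
  rewrite rmorph_prod /=; apply: eq_bigr => v /eqP va.
  by rewrite hY va rmorphXn.
rewrite -(bigA_distr_bigA (fun a t => psi t * (h a).@[y t])) /=.
have [a ha] : exists a, (\sum_(v | blk v == a) mon v < d)%N.
  apply/existsP; apply: contraT; rewrite negb_exists => /forallP big.
  have := leq_trans (msize_mdeg_lt monP) hP.
  rewrite mdegE (partition_big blk xpredT) //= ltnNge => /negP[].
  rewrite -[X in (X * _)%N]card_ord -sum_nat_const.
  by apply: leq_sum => a _; rewrite leqNgt big.
rewrite (bigD1 a) //= hpsi ?mul0r //.
exact: leq_trans (msize_prod_exp _ _ hq) ha.
Qed.
End Tensor.

(** * Attainment and monotonicity of the approximate degree *)

Section ApproxDegree.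
Variables (R : realType) (N : nat).
Implicit Types (eps : R) (X : set ('I_N -> R)) (f : ('I_N -> R) -> R).

Lemma approx_degP eps X f : (exists p, approximates eps X f p) ->
  (exists2 p, approximates eps X f p & total_degree p = approx_deg eps X f) /\
  (forall p, approximates eps X f p -> (approx_deg eps X f <= total_degree p)%N).
Proof.
move=> [p0 hp0]; rewrite /approx_deg; set S := (X in get X).
suff : exists d, S d by move/getPex.
pose D d := `[< exists2 p, approximates eps X f p & total_degree p = d >].
have exD : exists d, D d by exists (total_degree p0); apply/asboolP; exists p0.
case: (ex_minnP exD) => d /asboolP hd dmin.
by exists d; split=> // p hp; apply: dmin; apply/asboolP; exists p.
Qed.

Lemma approximatesW eps eps' X f p : eps <= eps' ->
  approximates eps X f p -> approximates eps' X f p.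
Proof. by move=> le hp x Xx; exact: le_trans (hp x Xx) le. Qed.

Lemma approx_deg_anti eps eps' X f : eps <= eps' ->
  (exists p, approximates eps X f p) -> (approx_deg eps' X f <= approx_deg eps X f)%N.
Proof.
move=> le ex; have [[p hp <-] _] := approx_degP ex.
have hp' := approximatesW le hp.
by apply: (approx_degP _).2; first by exists p.
Qed.

End ApproxDegree.

(** * Block diagonal inputs of the distinctness function *)

Section Distinctness.
Variable R : realType.

(** These are exactly the points of [ED_dom], the 1 of row [i] standing in column [g i]; functions
    [g] thus index the domain by a finite type. *)
Definition row_mat n (g : {ffun 'I_n -> 'I_n}) : 'I_(n * n) -> R :=
  fun v => mxvec (\matrix_(i, j) (g i == j)%:R) ord0 v.

Lemma row_matE n (g : {ffun 'I_n -> 'I_n}) i j : row_mat g (mxvec_index i j) = (g i == j)%:R.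
Proof. by rewrite /row_mat mxvecE mxE. Qed.

Lemma row_mat_dom n (g : {ffun 'I_n -> 'I_n}) : ED_dom (row_mat g).
Proof.
split=> [i j|i]; rewrite /entry.
  by rewrite row_matE; case: eqP; [right|left].
rewrite -(cards1 (g i)); congr #|pred_of_set _|; apply/setP => j.
by rewrite !inE row_matE [j == _]eq_sym; case: (g i == j); rewrite ?eqxx //= eq_sym oner_eq0.
Qed.

Lemma ED_dom_row_mat n (x : 'I_(n * n) -> R) : ED_dom x -> exists g, x = row_mat g.
Proof.
move=> [x01 x1]; have /choice[g hg] i : exists j, [set j | entry x i j == 1%R]%SET = [set j]%SET.
  by apply/cards1P; rewrite x1.
exists (finfun g); apply/funext => v; case/mxvec_indexP: v => i j.
have /setP/(_ j) := hg i; rewrite row_matE ffunE !inE [j == _]eq_sym => <-.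
by case: (x01 i j); rewrite /entry => ->; rewrite ?eqxx //= eq_sym oner_eq0.
Qed.

Definition small_fibers r n (g : {ffun 'I_n -> 'I_n}) : bool :=
  [forall j, #|[set i | g i == j]%SET| < r]%N.

Lemma ED_row_mat r n (g : {ffun 'I_n -> 'I_n}) : ED r (row_mat g) = (small_fibers r g)%:R.
Proof.
rewrite /ED; congr (nat_of_bool _)%:R; apply: eq_forallb => j.
congr (#|pred_of_set _| < _)%N; apply/setP => i.
by rewrite !inE /entry row_matE; case: (g i == j); rewrite ?eqxx //= eq_sym oner_eq0.
Qed.

Lemma approximates_ED eps r n (p : {mpoly R[n * n]}) :
  approximates eps (@ED_dom R n) (@ED R r n) p <->
  forall g, `|p.@[row_mat g] - (small_fibers r g)%:R| <= eps.
Proof.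
split=> [hp g|hp x /ED_dom_row_mat[g ->]]; last by rewrite ED_row_mat.
by rewrite -ED_row_mat; apply: hp; exact: row_mat_dom.
Qed.

(** Exact interpolation: the product of the variables at [(i, g i)] is 1 at [row_mat g] and 0 at
    every other point of the domain. *)
Lemma approximates_ED_exists eps r n : 0 <= eps ->
  exists p, approximates eps (@ED_dom R n) (@ED R r n) p.
Proof.
move=> eps0.
exists (\sum_(g : {ffun 'I_n -> 'I_n}) (small_fibers r g)%:R *: \prod_i 'X_(mxvec_index i (g i))).
apply/approximates_ED => g; rewrite raddf_sum /= (bigD1 g) //= [X in _ + X - _]big1 => [|g' g'g].
  rewrite mevalZ rmorph_prod /= big1 => [|i _]; last by rewrite mevalXU row_matE eqxx.
  by rewrite mulr1 addr0 subrr normr0.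
have [i gi] : exists i, g i != g' i.
  apply/existsP; apply: contraT; rewrite negb_exists => /forallP gg'.
  case/eqP: g'g; apply/ffunP => i; apply/esym/eqP; move: (gg' i); by rewrite negbK.
by rewrite mevalZ rmorph_prod /= (bigD1 i) //= mevalXU row_matE (negbTE gi) mul0r mulr0.
Qed.

(** No constant is within 1/3 of both 0 and 1, and both values occur: a constant map has a fiber of
    size [n >= r], the identity only fibers of size 1. *)
Lemma approx_deg_ED_gt0 r n : (2 <= r <= n)%N ->
  (0 < approx_deg (1 / 3) (@ED_dom R n) (@ED R r n))%N.
Proof.
move=> /andP[r2 rn]; rewrite lt0n; apply/eqP => d0.
have [|[p /approximates_ED hp pd] _] :=
    approx_degP (@approximates_ED_exists (1 / 3) r n _); first by lra.
have [c pc] : exists c, p = c%:MP.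
  exists p@_0; apply: msize1_polyC; move: pd; rewrite d0 /total_degree.
  by move: (mmeasure _ p) => k; lia.
have n0 : (0 < n)%N by lia.
have := hp [ffun i => i]; have := hp [ffun=> Ordinal n0].
rewrite pc !mevalC.
have -> : small_fibers r [ffun=> Ordinal n0] = false.
  apply/forallP => /(_ (Ordinal n0)); apply/negP; rewrite -leqNgt.
  rewrite [X in #|pred_of_set X|](_ : _ = [set: 'I_n]%SET) ?cardsT ?card_ord //.
  by apply/setP => i; rewrite !inE ffunE eqxx.
have -> : small_fibers r [ffun i : 'I_n => i].
  apply/forallP => j; rewrite [X in #|pred_of_set X|](_ : _ = [set j]%SET) ?cards1 //.
  by apply/setP => i; rewrite !inE ffunE.
rewrite /= !ler_norml; lra.
Qed.

Section Blocks.
Variables (n m k : nat) (mkn : (m * k <= n)%N).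

Definition block_pos (a : 'I_m) (b : 'I_k) : 'I_n := widen_ord mkn (mxvec_index a b).

Lemma block_pos_inj a b a' b' : block_pos a b = block_pos a' b' -> a = a' /\ b = b'.
Proof.
by move=> /(congr1 val) /= /val_inj /enum_rank_inj[-> ->].
Qed.

Variant block_spec (i : 'I_n) : Prop :=
  | InBlock a b of i = block_pos a b
  | OffBlocks of (forall a b, i != block_pos a b).

Lemma blockP i : block_spec i.
Proof.
case: (pickP [pred ab : 'I_m * 'I_k | i == block_pos ab.1 ab.2]) => [[a b] /eqP|h].
  exact: InBlock.
by apply: OffBlocks => a b; move: (h (a, b)) => /= ->.
Qed.

(* The rows outside the diagonal blocks are those of the identity matrix, so
   that no column outside the blocks holds more than a single 1. *)
Definition block_diag (G : {ffun 'I_m -> {ffun 'I_k -> 'I_k}}) : {ffun 'I_n -> 'I_n} :=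
  [ffun i => if [pick ab : 'I_m * 'I_k | i == block_pos ab.1 ab.2] is Some ab
             then block_pos ab.1 (G ab.1 ab.2) else i].

Lemma block_diag_in G a b : block_diag G (block_pos a b) = block_pos a (G a b).
Proof.
rewrite ffunE; case: pickP => [[a' b'] /= /eqP /block_pos_inj[<- <-] //|/(_ (a, b))].
by rewrite /= eqxx.
Qed.

Lemma block_diag_off G i : (forall a b, i != block_pos a b) -> block_diag G i = i.
Proof.
by move=> h; rewrite ffunE; case: pickP => [[a b]|//]; rewrite /= (negbTE (h a b)).
Qed.

(** A column in block [a] gets its ones from rows of that block only, so its fiber has the size it
    has in [G a]; any other column has a fiber of size at most [1 < r]. *)
Lemma small_fibers_block_diag r G : (2 <= r)%N ->
  small_fibers r (block_diag G) = [forall a, small_fibers r (G a)].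
Proof.
move=> r2.
have fib a c : #|[set i | block_diag G i == block_pos a c]%SET| = #|[set b | G a b == c]%SET|.
  have inj : injective (block_pos a) by move=> b b' /block_pos_inj[].
  rewrite -(card_imset _ inj); congr #|pred_of_set _|; apply/setP => i; rewrite inE.
  apply/eqP/imsetP => [|[b]]; last first.
    by rewrite inE => /eqP <- ->; rewrite block_diag_in.
  case: (blockP i) => [a' b ->|off].
    rewrite block_diag_in => /block_pos_inj[ea <-]; subst a'.
    by exists b; rewrite ?inE.
  by rewrite block_diag_off // => ei; have := off a c; rewrite ei eqxx.
apply/forallP/forallP => [h a|h j]; first by apply/forallP => c; rewrite -fib.
case: (blockP j) => [a c ->|off]; first by rewrite fib; move/forallP: (h a).
apply: leq_trans r2; rewrite ltnS -(cards1 j); apply: subset_leq_card.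
apply/fintype.subsetP => i; rewrite !inE; case: (blockP i) => [a b ->|off'].
  by rewrite block_diag_in => /eqP ej; have := off a (G a b); rewrite ej eqxx.
by rewrite block_diag_off.
Qed.

(** An entry is a variable of block [a] if its row and column both lie there, and constant
    otherwise; constants are assigned to the arbitrary block [a0]. *)
Lemma row_mat_block_diag (a0 : 'I_m) (v : 'I_(n * n)) :
  exists aq : 'I_m * {mpoly R[k * k]}, (msize aq.2 <= 2)%N /\
    forall G, row_mat (block_diag G) v = aq.2.@[row_mat (G aq.1)].
Proof.
have cst c : exists aq : 'I_m * {mpoly R[k * k]}, (msize aq.2 <= 2)%N /\
    forall G : {ffun 'I_m -> {ffun 'I_k -> 'I_k}}, c = aq.2.@[row_mat (G aq.1)].
  exists (a0, c%:MP); split=> [|G] /=; last by rewrite mevalC.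
  by rewrite msizeC; case: (c == 0).
case/mxvec_indexP: v => i j; case: (blockP i) => [a b ->|off]; last first.
  have [aq [aq2 haq]] := cst (i == j)%:R; exists aq; split=> // G.
  by rewrite row_matE block_diag_off.
have [[b' ->]|nj] := pselect (exists b', j = block_pos a b').
  exists (a, 'X_(mxvec_index b b')); split=> [|G] /=; first by rewrite msizeX mdeg1.
  rewrite mevalXU !row_matE block_diag_in; congr (nat_of_bool _)%:R.
  by apply/eqP/eqP => [/block_pos_inj[]|->].
have [aq [aq2 haq]] := cst 0; exists aq; split=> // G.
rewrite -haq row_matE block_diag_in; case: eqP => // ej.
by case: nj; exists (G a b).
Qed.

End Blocks.

(* A dual witness [psi] for the small instance has pure high degree [d], so its
   tensor power has pure high degree [m * d], while its correlation with the
   AND of the [m] blocks is at least [3 ^- m]. *)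
Lemma approx_deg_ED_blocks r n m k eps : (2 <= r)%N -> (0 < m)%N -> (m * k <= n)%N ->
  0 <= eps < 3 ^- m ->
  (m * approx_deg (1 / 3) (@ED_dom R k) (@ED R r k) <=
   approx_deg eps (@ED_dom R n) (@ED R r n))%N.
Proof.
move=> r2 m0 mkn /andP[eps0 epsm]; set d := approx_deg _ _ (@ED R r k).
(* With [d > 0], [msize p <= d] contradicts [d <= total_degree p]; at [d = 0] the zero polynomial
   would satisfy both. *)
have [->|d0] := posnP d; first by rewrite muln0.
have [[P /approximates_ED hP <-] _] := approx_degP (@approximates_ED_exists eps r n eps0).
rewrite leqNgt; apply/negP => degP.
have sizeP : (msize P <= m * d)%N.
  by move: degP; rewrite /total_degree; move: (mmeasure _ P) => s; lia.
pose T := {ffun 'I_k -> 'I_k}.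
pose V (u : {ffun T -> R^o}) := exists2 p : {mpoly R[k * k]}, (msize p <= d)%N &
  forall g, u g = p.@[row_mat g].
pose f : {ffun T -> R^o} := [ffun g => (small_fibers r g)%:R].
have [|||v [p pd hp]|psi [psi1 psif psiV]] := @uniform_distance_dual R T V f (1 / 3).
- by exists 0 => [|g]; rewrite ?msize0 // ffunE meval0.
- move=> u v [p pd hp] [q qd hq]; exists (p + q) => [|g].
    by apply: leq_trans (msizeD_le _ _) _; rewrite geq_max pd.
  by rewrite ffunE hp hq mevalD.
- move=> a u [p pd hp]; exists (a *: p) => [|g].
    exact: leq_trans (msizeZ_le _ _) pd.
  by rewrite ffunE hp mevalZ.
- have /existsNP[g hg] : ~ forall g, `|p.@[row_mat g] - (small_fibers r g)%:R| <= 1 / 3.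
    move=> /approximates_ED hp'.
    have third0 : 0 <= 1 / 3 :> R by lra.
    have := (approx_degP (@approximates_ED_exists (1 / 3) r k third0)).2 p hp'.
    by rewrite -/d /total_degree; move: pd; move: (mmeasure _ p) => s; lia.
  exists g; rewrite ffunE hp distrC; apply: ltW; rewrite ltNge; exact/negP.
have hpsi : pure_high (@row_mat k) d psi.
  move=> p pd; have := psiV [ffun g => p.@[row_mat g]].
  under eq_bigr do rewrite ffunE.
  by apply; exists p => // g; rewrite ffunE.
have /choice[aq haq] := row_mat_block_diag mkn (Ordinal m0).
have := pure_high_tensor (Y := fun G => row_mat (block_diag mkn G)) (blk := fun v => (aq v).1)
  (fun v => (haq v).1) (fun G v => (haq v).2 G) hpsi sizeP.
have corr : \sum_(G : {ffun 'I_m -> T}) (\prod_a psi (G a)) *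
    (small_fibers r (block_diag mkn G))%:R = (\sum_g psi g * f g) ^+ m.
  rewrite -[in RHS](card_ord m) -prodr_const bigA_distr_bigA /=.
  apply: eq_bigr => G _; rewrite big_split /= small_fibers_block_diag //; congr (_ * _).
  have [/forallP hG|] := boolP [forall a, small_fibers r (G a)].
    by rewrite big1 // => a _; rewrite ffunE hG.
  by rewrite negb_forall => /existsP[a /negbTE ha]; rewrite (bigD1 a) //= ffunE ha mul0r.
(* The l1-norm of a tensor power is the power of the l1-norm, hence at most 1. *)
have err : `|\sum_(G : {ffun 'I_m -> T}) (\prod_a psi (G a)) * (P.@[row_mat (block_diag mkn G)] -
    (small_fibers r (block_diag mkn G))%:R)| <= eps.
  apply: le_trans (ler_norm_sum _ _ _) _.
  apply: (@le_trans _ _ (\sum_(G : {ffun 'I_m -> T}) (\prod_a `|psi (G a)|) * eps)).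
    by apply: ler_sum => G _; rewrite normrM normr_prod ler_wpM2l // prodr_ge0.
  rewrite -mulr_suml -(bigA_distr_bigA (fun _ g => `|psi g|)) /= prodr_const card_ord.
  by rewrite ler_piMl ?exprn_ile1 // sumr_ge0.
(* Orthogonality removes [P], so the correlation, at least [(1 / 3) ^+ m], would be at most
   [eps]. *)
move=> orth; move: err; under eq_bigr do rewrite mulrBr.
rewrite sumrB orth corr sub0r normrN ger0_norm; last by rewrite exprn_ge0 //; lra.
move=> h; have : (1 / 3) ^+ m <= (\sum_g psi g * f g) ^+ m by rewrite lerXn2r ?nnegrE; lra.
by rewrite div1r exprVn; lra.
Qed.

End Distinctness.

(** * Choice of the number of blocks and the final estimate *)

(** The exponents [l] and [1 - l] of [a] add up to 1. It serves with [a] the number of blocks, [k]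
    their size, [x = n] and [y = ln (1 / eps)]. *)
Lemma powR_interpolation (R : realType) (l A B a k x y : R) :
  0 <= l <= 1 -> 1 <= A -> 1 <= B -> 0 < a -> 0 <= k ->
  0 <= x <= A * a * k -> 0 <= y <= B * a ->
  x `^ l * y `^ (1 - l) <= A * B * (a * k `^ l).
Proof.
move=> /andP[l0 l1] A1 B1 a0 k0 /andP[x0 xA] /andP[y0 yB].
have xl : x `^ l <= A * (a `^ l * k `^ l).
  apply: (@le_trans _ _ ((A * a * k) `^ l)); first by apply: ge0_ler_powR; rewrite ?nnegrE //; nra.
  rewrite !powRM ?mulr_ge0 //; try lra.
  by rewrite -mulrA ler_wpM2r ?mulr_ge0 ?powR_ge0 // ler1_powR.
have yl : y `^ (1 - l) <= B * a `^ (1 - l).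
  apply: (@le_trans _ _ ((B * a) `^ (1 - l))); first by apply: ge0_ler_powR; rewrite ?nnegrE //; nra.
  rewrite powRM; try lra.
  by rewrite ler_wpM2r ?powR_ge0 // ler1_powR //; lra.
have aE : a `^ l * a `^ (1 - l) = a.
  rewrite -powRD; last by rewrite (gt_eqF a0) implybT.
  by rewrite addrC subrK powRr1 // ltW.
apply: le_trans (ler_pM (powR_ge0 _ _) (powR_ge0 _ _) xl yl) _.
by rewrite -{3}aE le_eqVlt; apply/orP; left; apply/eqP; ring.
Qed.

(** The witness is the largest [q] with [eps <= 3 ^- q]; the lower bound on [eps] caps such [q] by
    [n]. *)
Lemma log3_bracket (R : realType) (n : nat) (eps : R) : 3 ^- n <= eps <= 1 / 3 ->
  exists q, (0 < q <= n)%N /\ 3 ^- q.+1 < eps <= 3 ^- q.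
Proof.
move=> /andP[neps eps3].
have ex : exists q, eps <= 3 ^- q by exists 1%N; rewrite expr1 -div1r.
have ub q : eps <= 3 ^- q -> (q <= n)%N.
  move=> /(le_trans neps); rewrite lef_pV2 ?posrE ?exprn_gt0 //.
  by rewrite ler_eXn2l // ltr1n.
case: (ex_maxnP ex ub) => q hq qmax; exists q; split.
  by rewrite ub // andbT; apply: qmax; rewrite expr1 -div1r.
by rewrite hq andbT ltNge; apply/negP => /qmax; rewrite ltnn.
Qed.

(** Take [m = q %/ r]: then [r * m <= q <= n] leaves blocks of size at least [r], and [m < q] makes
    [eps < 3 ^- m] strict. If [q < r], a single block and monotonicity in [eps] suffice. *)
Lemma approx_deg_ED_amplify (R : realType) r n (eps : R) q : (2 <= r <= n)%N ->
  (0 < q <= n)%N -> 0 <= eps <= 1 / 3 -> eps <= 3 ^- q -> exists m,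
    [/\ (0 < m)%N, (r * m <= n)%N, (q < 2 * r * m)%N &
      (m * approx_deg (1 / 3) (@ED_dom R (n %/ m)) (@ED R r (n %/ m)) <=
       approx_deg eps (@ED_dom R n) (@ED R r n))%N].
Proof.
move=> /andP[r2 rn] /andP[q0 qn] /andP[eps0 eps3] epsq.
have qE := divn_eq q r; have := ltn_pmod q (ltnW r2 : 0 < r)%N => qr.
have [m0|m_gt0] := posnP (q %/ r)%N.
  exists 1%N; rewrite divn1 mul1n muln1; split=> //.
    by rewrite m0 in qE; lia.
  exact: approx_deg_anti eps3 (approximates_ED_exists _ _ eps0).
exists (q %/ r)%N; split=> //; [nia|nia|].
apply: approx_deg_ED_blocks => //; first by rewrite mulnC leq_trunc_div.
rewrite eps0; apply: le_lt_trans epsq _.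
rewrite ltf_pV2 ?posrE ?exprn_gt0 //.
by rewrite ltr_eXn2l ?ltr1n // ltn_Pdiv.
Qed.

Theorem theorem3p4 (R : realType) (r : nat) (l : R) :
  (2 <= r)%N ->
  0 <= l <= 1 ->
  (exists c : R, 0 < c /\ exists N : nat, forall n : nat, (N <= n)%N ->
     c * n%:R `^ l <= (approx_deg (1 / 3) (@ED_dom R n) (@ED R r n))%:R) ->
  exists c : R, 0 < c /\
    forall (n : nat) (eps : R), (r <= n)%N -> 3 ^- n <= eps <= 1 / 3 ->
      c * (n%:R `^ l * ln (1 / eps) `^ (1 - l)) <=
        (approx_deg eps (@ED_dom R n) (@ED R r n))%:R.
Proof.
move=> r2 l01 [c [c0 [N hN]]].
pose c1 : R := Num.min c N.+1%:R^-1.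
have c1_gt0 : 0 < c1 by rewrite lt_min c0 invr_gt0 ltr0n.
have hk k : (r <= k)%N ->
    c1 * k%:R `^ l <= (approx_deg (1 / 3) (@ED_dom R k) (@ED R r k))%:R.
  move=> rk; have [Nk|kN] := leqP N k.
    by apply: le_trans (hN k Nk); rewrite ler_wpM2r ?powR_ge0 // ge_min lexx.
  apply: (@le_trans _ _ 1); last by rewrite ler1n approx_deg_ED_gt0 // r2.
  apply: (@le_trans _ _ (N.+1%:R^-1 * k%:R `^ l)).
    by rewrite ler_wpM2r ?powR_ge0 // ge_min lexx orbT.
  rewrite ler_pdivrMl ?ltr0n // mulr1; apply: (@le_trans _ _ k%:R).
    by apply: ler1_powR; [rewrite ler1n; lia|case/andP: l01].
  by rewrite ler_nat; lia.
have r_gt0 : 0 < r%:R :> R by rewrite ltr0n; lia.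
(* The factor 2 is lost in rounding [n / m] down, the factor [6 * r] in comparing [ln (1 / eps)]
   with [m]. *)
exists (c1 / (2 * (6 * r%:R))); split; first by rewrite divr_gt0 // !mulr_gt0.
move=> n eps rn heps; have /andP[neps eps3] := heps.
have eps_gt0 : 0 < eps by apply: lt_le_trans neps; rewrite invr_gt0 exprn_gt0.
have [q [qn /andP[qeps epsq]]] := log3_bracket heps.
have [||m [m0 rmn qm degm]] := @approx_deg_ED_amplify R r n eps q _ qn _ epsq.
- by rewrite r2.
- by rewrite ltW.
have lnE : ln (1 / eps) = - ln eps by rewrite div1r lnV ?posrE.
(* Here [ln (1 / eps) <= q.+1 * ln 3], where [ln 3 < 3] and [q.+1 <= 2 * r * m]. *)
have ln_le : ln (1 / eps) <= 6 * r%:R * m%:R.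
  apply: (@le_trans _ _ (q.+1%:R * 3)).
    apply: (@le_trans _ _ (ln (3 ^+ q.+1))).
      rewrite ler_ln ?posrE ?exprn_gt0 ?divr_gt0 //.
      rewrite div1r -[leRHS]invrK lef_pV2 ?posrE ?invr_gt0 ?exprn_gt0 //.
      exact: ltW.
    by rewrite lnXn // -(mulr_natl (ln 3)) ler_wpM2l // ltW // ln_sublinear.
  rewrite (_ : 6 * r%:R * m%:R = (2 * r * m)%:R * 3); first by rewrite ler_wpM2r // ler_nat.
  by rewrite !natrM; ring.
have ln_ge0 : 0 <= ln (1 / eps).
  by rewrite lnE oppr_ge0 ln_le0 //; lra.
have rk : (r <= n %/ m)%N by rewrite leq_divRL.
(* Since [n %/ m >= 1], the remainder, which is below [m], is at most [m * (n %/ m)]. *)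
have nk : n%:R <= 2 * m%:R * (n %/ m)%:R :> R.
  rewrite -!natrM ler_nat; have := divn_eq n m; have := ltn_pmod n m0.
  by move: (n %/ m)%N (n %% m)%N rk => k s; nia.
have main := @powR_interpolation R l 2 (6 * r%:R) m%:R (n %/ m)%:R n%:R (ln (1 / eps)) l01.
rewrite mulrAC ler_pdivrMr ?mulr_gt0 //.
apply: (@le_trans _ _ (c1 * (2 * (6 * r%:R) * (m%:R * (n %/ m)%:R `^ l)))).
  rewrite ler_pM2l //; apply: main; rewrite ?ler0n ?ltr0n ?nk ?ln_ge0 ?ln_le //.
    by lra.
  by have : 1 <= r%:R :> R; [rewrite ler1n; lia|lra].
rewrite (_ : c1 * _ = (m%:R * (c1 * (n %/ m)%:R `^ l)) * (2 * (6 * r%:R))); last by ring.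
rewrite ler_pM2r ?mulr_gt0 //.
apply: le_trans (_ : m%:R * (approx_deg (1 / 3) (@ED_dom R (n %/ m)) (@ED R r (n %/ m)))%:R <= _).
  by rewrite ler_pM2l ?ltr0n // hk.
by rewrite -natrM ler_nat.
Qed.
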